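(* Let $M_n \subseteq \mathbb{R}^p$ be a non-random Borel set satisfying Condition A with matrix $\bar C = C_n$. Then $$\inf_{\beta \in \mathbb{R}^p} P_\beta(\hat u_n \in M_n) = \min_{d \in \{-1,1\}^p} P(\hat u_n^d \in M_n),$$ where $\hat u_n^d \sim N(-n^{-1/2}C_n^{-1}\Lambda_n d,\ \sigma^2 C_n^{-1})$.
   Context: Model: $y = X\beta + \varepsilon$, where $X$ is a non-random real $n\times p$ matrix of full column rank $p$ (so $p \le n$), $\beta \in \mathbb{R}^p$ is the unknown parameter, and $\varepsilon \sim N(0,\sigma^2 I_n)$. $P_\beta$ denotes probability when the true parameter is $\beta$. Let $\lambda_{n,1},\dots,\lambda_{n,p} \ge 0$ be non-random tuning parameters and $\Lambda_n = \mathrm{diag}(\lambda_{n,1},\dots,\lambda_{n,p})$. The Lasso estimator $\hat\beta_L$ is the unique minimizer over $b \in \mathbb{R}^p$ of $L_n(b) = \|y - Xb\|^2 + 2\sum_{j=1}^p \lambda_{n,j}|b_j|$. Put $\hat u_n = n^{1/2}(\hat\beta_L - \beta)$, $C_n = X'X/n$, $W_n = n^{-1/2}X'\varepsilon$. For $d \in \{-1,1\}^p$, $\hat u_n^d$ is the unique minimizer over $u\in\mathbb{R}^p$ of $Q_n^d(u) = u'C_nu - 2u'W_n + 2n^{-1/2}\sum_{j=1}^p \lambda_{n,j}d_ju_j$. For $m \in \mathbb{R}^p$, $d \in \{-1,1\}^p$ and $\bar C \in \mathbb{R}^{p\times p}$ let $A^d_{\bar C}(m) = \bigcap_{j=1}^p\{z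 \in \mathbb{R}^p : d_j(\bar Cm)_j \le d_j(\bar Cz)_j,\ d_jz_j \le 0\}$. A set $M\subseteq \mathbb{R}^p$ satisfies Condition A with matrix $\bar C$ if $A^d_{\bar C}(m) \subseteq M$ for all $d \in \{-1,1\}^p$ and all $m \in M$. *)

(* Defs.v *)
From HB Require Import structures.
From mathcomp Require Import all_boot all_order all_algebra.
From mathcomp Require Import all_classical all_reals all_analysis.

Set Implicit Arguments.
Unset Strict Implicit.
Unset Printing Implicit Defensive.

Import Order.TTheory GRing.Theory Num.Theory.
Import numFieldNormedType.Exports.

Local Open Scope classical_set_scope.
Local Open Scope ring_scope.

(* Vectors of R^k are columns 'cV[R]_k; Lambda_n is given by its diagonal
   lam : 'rV[R]_p, so that Lambda_n = diag_mx lam. *)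

Definition dotv (R : realType) (k : nat) (u v : 'cV[R]_k) : R :=
  \sum_i u i 0 * v i 0.

(* The norm `|v| provided by the library on matrices is the sup norm, whence
   this separate definition of the squared Euclidean norm. *)
Definition sqnorm (R : realType) (k : nat) (v : 'cV[R]_k) : R := dotv v v.

Definition borel_set (R : realType) (k : nat) (B : set 'cV[R]_k) : Prop :=
  <<s [set U : set 'cV[R]_k | open U] >> B.

(* The univariate normal law with mean m and variance v. The library's
   normal_prob takes the standard deviation, and is not the point mass when
   the latter is 0. *)
Definition normal_law (R : realType) (m v : R) : set R -> \bar R :=
  if v == 0 then (\d_m : set R -> \bar R) else normal_prob m (Num.sqrt v).

(* Z ~ N(mu, Sigma) under P: each linear form a'Z is a random variable with
   law N(a'mu, a' Sigma a). *)
Definition is_normal (d : measure_display) (T : measurableType d)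
    (R : realType) (P : probability T R) (k : nat) (Z : T -> 'cV[R]_k)
    (mu : 'cV[R]_k) (Sigma : 'M[R]_k) : Prop :=
  forall a : 'cV[R]_k,
    measurable_fun [set: T] (fun w => dotv a (Z w)) /\
    forall B : set R, measurable B ->
      pushforward P (fun w => dotv a (Z w)) B =
      normal_law (dotv a mu) (dotv a (Sigma *m a)) B.

Definition is_unique_minimizer (R : realType) (k : nat) (f : 'cV[R]_k -> R)
    (x : 'cV[R]_k) : Prop :=
  forall z, z != x -> f x < f z.

(* The unique minimizer of f (the value is 0 if there is none). *)
Definition argmin (R : realType) (k : nat) (f : 'cV[R]_k -> R) : 'cV[R]_k :=
  xget 0 [set x | is_unique_minimizer f x].

(* d : {ffun 'I_p -> bool} encodes the element of {-1, 1}^p whose j-th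
   coordinate is (-1) ^+ d j. *)
Definition sign_vec (R : realType) (p : nat) (d : {ffun 'I_p -> bool}) :
    'cV[R]_p :=
  \col_j (-1) ^+ d j.
Arguments sign_vec R {p} d.

Section Lasso.
Variables (R : realType) (n p : nat) (X : 'M[R]_(n, p)) (lam : 'rV[R]_p).

Definition lasso_obj (y : 'cV[R]_n) (b : 'cV[R]_p) : R :=
  sqnorm (y - X *m b) + 2 * \sum_j lam 0 j * `|b j 0|.

Definition lasso (y : 'cV[R]_n) : 'cV[R]_p := argmin (lasso_obj y).

(* The scaled estimation error, as a function of the true parameter and of the
   value e of the noise. *)
Definition uhat (beta : 'cV[R]_p) (e : 'cV[R]_n) : 'cV[R]_p :=
  Num.sqrt n%:R *: (lasso (X *m beta + e) - beta).

Definition gram : 'M[R]_p := n%:R^-1 *: (X^T *m X).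

Definition score (e : 'cV[R]_n) : 'cV[R]_p :=
  (Num.sqrt n%:R)^-1 *: (X^T *m e).

Definition Qd (d : {ffun 'I_p -> bool}) (e : 'cV[R]_n) (u : 'cV[R]_p) : R :=
  dotv u (gram *m u) - 2 * dotv u (score e)
  + 2 * (Num.sqrt n%:R)^-1 * \sum_j lam 0 j * sign_vec R d j 0 * u j 0.

Definition uhatd (d : {ffun 'I_p -> bool}) (e : 'cV[R]_n) : 'cV[R]_p :=
  argmin (Qd d e).

End Lasso.

Definition setA (R : realType) (p : nat) (C : 'M[R]_p)
    (d : {ffun 'I_p -> bool}) (m : 'cV[R]_p) : set 'cV[R]_p :=
  [set z | forall j,
    sign_vec R d j 0 * (C *m m) j 0 <= sign_vec R d j 0 * (C *m z) j 0 /\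
    sign_vec R d j 0 * z j 0 <= 0].

Definition conditionA (R : realType) (p : nat) (C : 'M[R]_p)
    (M : set 'cV[R]_p) : Prop :=
  forall (d : {ffun 'I_p -> bool}) (m : 'cV[R]_p), M m -> setA C d m `<=` M.

(* Main.v *)
Require Import Defs.
From HB Require Import structures.
From mathcomp Require Import all_boot all_order all_algebra.
From mathcomp Require Import all_classical all_reals all_analysis.
From mathcomp Require Import measurable_realfun.
From mathcomp Require Import ring lra.

Set Implicit Arguments.
Unset Strict Implicit.
Unset Printing Implicit Defensive.

Import Order.TTheory GRing.Theory Num.Theory.
Import numFieldNormedType.Exports.

Local Open Scope classical_set_scope.
Local Open Scope ring_scope.

(** Write C for the Gram matrix X'X/n, b for the Lasso estimate when the true
    parameter is beta, and g = X'(y - X b). Convexity makes optimality of b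
    equivalent to g being a subgradient at b of the separable penalty
    sum_j lam_j |b_j| ([minimizer_subgrad], [subgrad_lasso_obj]). So |g_j| <=
    lam_j, with g_j = lam_j when b_j > 0 and g_j = - lam_j when b_j < 0. The
    quadratic problem Q^d replaces the penalty by a linear one, that is, g by
    Lambda d. In terms of the scaled errors,
      C uhat - C uhat^d = n^(-1/2) (Lambda d - g).

    Lower bound ([uhatd_in_uhat_in]). Fix beta and let d_j = -1 if beta_j < 0
    and d_j = 1 otherwise. If uhat_j > 0, then b_j > beta_j, and the identity
    above gives (C uhat)_j <= (C uhat^d)_j: either d_j = -1, or b_j > 0 and
    g_j = lam_j. If uhat_j <= 0, the inequality is reversed for similar reasons.
    Hence uhat lies in A^d'(uhat^d) for d'_j = -1 if uhat_j > 0 and d'_j = 1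
    otherwise, and Condition A turns uhat^d in M into uhat in M. This is
    an inclusion of events for every beta, hence the infimum is at least the
    minimum.

    Upper bound ([inf_uhat_le]). Take beta = t d with t large. As soon as t
    exceeds all - d_j uhat^d_j / sqrt n, the point beta + uhat^d / sqrt n has
    the sign pattern d, so that Lambda d is a subgradient of the penalty there,
    and uhat = uhat^d. The exceptional events decrease to the empty set as t
    grows, so their probability tends to 0.

    Probabilities of these events make sense because the Lasso depends
    continuously on the data: the fit X b is a nonexpansive function of y
    ([lasso_nonexpansive]), and X has a left inverse. Finally, uhat^d is an
    affine function of the noise, which gives its law; the only fact about
    normal laws that is needed is how they are translated
    ([normal_law_shift]). *)

(** * Inner products of column vectors *)

Section EuclideanProduct.
Variable R : realType.

Lemma dotvE k (u v : 'cV[R]_k) : dotv u v = (u^T *m v) 0 0.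
Proof. by rewrite mxE; apply: eq_bigr => i _; rewrite mxE. Qed.

Lemma dotvC k (u v : 'cV[R]_k) : dotv u v = dotv v u.
Proof. by apply: eq_bigr => i _; rewrite mulrC. Qed.

Lemma dotvDl k (u v w : 'cV[R]_k) : dotv (u + v) w = dotv u w + dotv v w.
Proof. by rewrite !dotvE linearD mulmxDl mxE. Qed.

Lemma dotvNl k (u w : 'cV[R]_k) : dotv (- u) w = - dotv u w.
Proof. by rewrite !dotvE linearN mulNmx mxE. Qed.

Lemma dotvZl k c (u w : 'cV[R]_k) : dotv (c *: u) w = c * dotv u w.
Proof. by rewrite !dotvE linearZ -scalemxAl mxE. Qed.

Lemma dotvDr k (u v w : 'cV[R]_k) : dotv w (u + v) = dotv w u + dotv w v.
Proof. by rewrite dotvC dotvDl !(dotvC w). Qed.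

Lemma dotvNr k (u w : 'cV[R]_k) : dotv w (- u) = - dotv w u.
Proof. by rewrite dotvC dotvNl (dotvC w). Qed.

Lemma dotvZr k c (u w : 'cV[R]_k) : dotv w (c *: u) = c * dotv w u.
Proof. by rewrite dotvC dotvZl (dotvC w). Qed.

Definition dotvl := (dotvDl, dotvDr, dotvNl, dotvNr, dotvZl, dotvZr).

Lemma dotv_mull m k (A : 'M[R]_(m, k)) u v :
  dotv (A *m u) v = dotv u (A^T *m v).
Proof. by rewrite !dotvE trmx_mul mulmxA. Qed.

Lemma sqnormD k (u v : 'cV[R]_k) :
  sqnorm (u + v) = sqnorm u + 2 * dotv u v + sqnorm v.
Proof. by rewrite /sqnorm !dotvl (dotvC v u); ring. Qed.

Lemma sqnormZ k c (u : 'cV[R]_k) : sqnorm (c *: u) = c ^+ 2 * sqnorm u.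
Proof. by rewrite /sqnorm !dotvl; ring. Qed.

Lemma sqnormN k (u : 'cV[R]_k) : sqnorm (- u) = sqnorm u.
Proof. by rewrite /sqnorm !dotvl opprK. Qed.

Lemma sqr_coord_le k (u : 'cV[R]_k) i : u i 0 ^+ 2 <= sqnorm u.
Proof.
rewrite /sqnorm /dotv (bigD1 i)//= expr2 lerDl.
by apply: sumr_ge0 => j _; rewrite -expr2 sqr_ge0.
Qed.

Lemma sqnorm_ge0 k (u : 'cV[R]_k) : 0 <= sqnorm u.
Proof. by apply: sumr_ge0 => j _; rewrite -expr2 sqr_ge0. Qed.

Lemma sqnorm_gt0 k (u : 'cV[R]_k) : u != 0 -> 0 < sqnorm u.
Proof.
rewrite lt_neqAle sqnorm_ge0 andbT; apply: contra => /eqP u0.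
apply/eqP/colP => i; rewrite mxE; apply/eqP.
by rewrite -sqrf_eq0 eq_le sqr_ge0 u0 sqr_coord_le.
Qed.

End EuclideanProduct.

(** * Limits of sums, minimizers and sign vectors *)

Lemma cvg_sumr (R : realType) (T : topologicalType) (x : T) k
    (f : 'I_k -> T -> R) (a : 'I_k -> R) :
  (forall i, f i z @[z --> x] --> a i) ->
  \sum_i f i z @[z --> x] --> \sum_i a i.
Proof.
by move=> fa; apply: (@cvg_big R) => //; exact: add_continuous.
Qed.

Lemma argminE (R : realType) k (f : 'cV[R]_k -> R) x :
  is_unique_minimizer f x -> argmin f = x.
Proof.
move=> fx; apply: xget_unique => // z fz; apply/eqP/negPn/negP => zx.
have xz : x != z by rewrite eq_sym.
by have := lt_trans (fx _ zx) (fz _ xz); rewrite ltxx.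
Qed.

Lemma sign_vecE (R : realType) p (d : {ffun 'I_p -> bool}) j :
  sign_vec R d j 0 = (-1) ^+ d j.
Proof. by rewrite mxE. Qed.

(** * Subgradients of the weighted l1 norm *)

Section Subgradient.
Variables (R : realType) (p : nat) (lam : 'rV[R]_p).
Hypothesis lam_ge0 : forall j, 0 <= lam 0 j.

(** The penalty is separable, so that its subdifferential is the product of the
    subdifferentials of the functions x |-> lam_j |x|. *)
Definition subgrad (g b : 'cV[R]_p) :=
  forall j x, g j 0 * (x - b j 0) <= lam 0 j * (`|x| - `|b j 0|).

(** A subgradient is bounded by the Lipschitz constant of the function; the
    increments -1 and 1 already show it. *)
Lemma subgrad_le g b : subgrad g b -> forall j, `|g j 0| <= lam 0 j.
Proof.
move=> gb j; rewrite ler_norml; apply/andP; split.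
  have := gb j (b j 0 - 1); have := ler_normD (b j 0) (- 1).
  rewrite normrN1; have := lam_ge0 j; nra.
have := gb j (b j 0 + 1); have := ler_normD (b j 0) 1.
rewrite normr1; have := lam_ge0 j; nra.
Qed.

(** The penalty is positively homogeneous: Euler's identity, obtained by testing
    the subgradient inequality at 0 and at twice the point. *)
Lemma subgrad_mul g b : subgrad g b ->
  forall j, g j 0 * b j 0 = lam 0 j * `|b j 0|.
Proof.
move=> gb j; apply/eqP; rewrite eq_le; apply/andP; split.
  have := gb j (2 * b j 0); rewrite normrM ger0_norm//; lra.
have := gb j 0; rewrite normr0; lra.
Qed.

Lemma subgrad_pos g b j : subgrad g b -> 0 < b j 0 -> g j 0 = lam 0 j.
Proof.
move=> /subgrad_mul/(_ j) + b0; rewrite gtr0_norm// => /mulIf; apply.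
by rewrite gt_eqF.
Qed.

Lemma subgrad_neg g b j : subgrad g b -> b j 0 < 0 -> g j 0 = - lam 0 j.
Proof.
move=> /subgrad_mul/(_ j) + b0; rewrite ltr0_norm// mulrN -mulNr => /mulIf.
by apply; rewrite lt_eqF.
Qed.

(** Weak sign agreement is enough: where b_j = 0, both signs are subgradients of
    the absolute value. *)
Lemma subgrad_sign (d : {ffun 'I_p -> bool}) (b : 'cV[R]_p) :
  (forall j, 0 <= sign_vec R d j 0 * b j 0) ->
  subgrad (diag_mx lam *m sign_vec R d) b.
Proof.
move=> db j x; rewrite mul_diag_mx !mxE -mulrA ler_wpM2l//.
have := db j; rewrite mxE; case: (d j); rewrite ?expr0 ?expr1.
  rewrite mulN1r oppr_ge0 => b0; rewrite (ler0_norm b0).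
  by rewrite mulN1r opprB opprK addrC lerD2r ler_normr lexx orbT.
by rewrite !mul1r => b0; rewrite (ger0_norm b0) lerD2r ler_norm.
Qed.

End Subgradient.

(** Divide by t and let t tend to 0: the first-order condition for a minimum at
    the left end of an interval. *)
Lemma slope_ge0 (R : realType) (q c : R) :
  (forall t, 0 < t -> t < 1 -> 0 <= t ^+ 2 * q + t * c) -> 0 <= c.
Proof.
move=> h; rewrite leNgt; apply/negP => c0.
(* For c < 0, this t lies in (0, 1) and makes t * q smaller than - c. *)
pose t := - c / (2 * (1 + `|q| - c)).
have q0 : 0 <= `|q| := normr_ge0 q.
have D0 : 0 < 2 * (1 + `|q| - c) by lra.
have tD : t * (2 * (1 + `|q| - c)) = - c by rewrite divfK// gt_eqF.
have t0 : 0 < t by rewrite divr_gt0// oppr_gt0.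
have t1 : t < 1 by nra.
have := h t t0 t1; rewrite expr2 -mulrA -mulrDr pmulr_rge0// => {}h.
have : t * q <= t * `|q| by rewrite ler_pM2l// ler_norm.
nra.
Qed.

(** * Optimality, existence and continuity of the Lasso *)

Section LassoOptimality.
Variables (R : realType) (n p : nat) (X : 'M[R]_(n, p)) (lam : 'rV[R]_p).
Hypothesis X_full : \rank X = p.
Hypothesis lam_ge0 : forall j, 0 <= lam 0 j.

Lemma pinvmx_leftK : pinvmx X *m X = 1%:M.
Proof. by apply: mulVpmx; rewrite /row_full X_full. Qed.

(** The objective expands exactly around any point b. The last sum is the defect
    in the subgradient inequality at b, which gives both directions of the
    optimality condition. *)
Lemma lasso_objB y b z :
  lasso_obj X lam y z - lasso_obj X lam y b =
  sqnorm (X *m (z - b))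
  + 2 * \sum_j (lam 0 j * (`|z j 0| - `|b j 0|)
                - (X^T *m (y - X *m b)) j 0 * (z j 0 - b j 0)).
Proof.
rewrite big_split/= sumrN.
have -> : \sum_j (X^T *m (y - X *m b)) j 0 * (z j 0 - b j 0) =
          dotv (y - X *m b) (X *m (z - b)).
  rewrite [RHS]dotvC dotv_mull dotvC.
  by apply: eq_bigr => j _; rewrite !mxE.
have -> : \sum_j lam 0 j * (`|z j 0| - `|b j 0|) =
   \sum_j lam 0 j * `|z j 0| - \sum_j lam 0 j * `|b j 0|.
  by rewrite -sumrB; apply: eq_bigr => j _; rewrite mulrBr.
rewrite /lasso_obj.
have -> : y - X *m z = (y - X *m b) - X *m (z - b).
  by rewrite mulmxBr opprB addrA subrK.
by rewrite (sqnormD (y - X *m b)) sqnormN dotvNr; ring.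
Qed.

(** The quadratic growth of the objective around its minimizer. It yields
    uniqueness, and the stability of the minimizer under changes of y. *)
Lemma subgrad_lasso_obj y b :
  subgrad lam (X^T *m (y - X *m b)) b ->
  forall z, lasso_obj X lam y b + sqnorm (X *m (z - b)) <= lasso_obj X lam y z.
Proof.
move=> gb z; rewrite -subr_ge0 opprD addrA lasso_objB.
rewrite addrAC subrr add0r mulr_ge0//; apply: sumr_ge0 => j _.
by rewrite subr_ge0; exact: gb.
Qed.

Lemma mulX_neq0 (u : 'cV[R]_p) : u != 0 -> X *m u != 0.
Proof.
apply: contra => /eqP Xu; apply/eqP.
by rewrite -(mul1mx u) -pinvmx_leftK -mulmxA Xu mulmx0.
Qed.

Lemma subgrad_unique_minimizer y b :
  subgrad lam (X^T *m (y - X *m b)) b ->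
  is_unique_minimizer (lasso_obj X lam y) b.
Proof.
move=> /subgrad_lasso_obj gb z zb; apply: lt_le_trans (gb z).
by rewrite ltrDl sqnorm_gt0// mulX_neq0// subr_eq0.
Qed.

(** Only the j-th coordinate is moved, from b_j a small fraction t of the way to
    x. By convexity of the absolute value the penalty grows by at most t times
    its total increase, whereas the quadratic term is of order t ^ 2. *)
Lemma minimizer_subgrad y b :
  (forall z, lasso_obj X lam y b <= lasso_obj X lam y z) ->
  subgrad lam (X^T *m (y - X *m b)) b.
Proof.
move=> bmin j x; set g := X^T *m _.
pose h := (x - b j 0) *: (delta_mx j 0 : 'cV[R]_p).
have hj k : h k 0 = if k == j then x - b j 0 else 0.
  by rewrite !mxE eqxx andbT; case: eqP => _; rewrite ?mulr1 ?mulr0.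
rewrite -subr_ge0 -(pmulr_rge0 _ (ltr0Sn R 1)).
apply: (@slope_ge0 _ (sqnorm (X *m h))) => t t0 t1.
have := bmin (b + t *: h); rewrite -subr_ge0 lasso_objB.
rewrite addrAC subrr add0r -scalemxAr sqnormZ => /le_trans; apply.
rewrite lerD2l mulrCA ler_pM2l// (bigD1 j)//= big1 => [|k kj]; last first.
  by rewrite !mxE (negbTE kj) !(mulr0, addr0, subrr).
rewrite addr0 -/g [(b + t *: h) j 0]mxE [(t *: h) j 0]mxE hj eqxx.
have -> : b j 0 + t * (x - b j 0) - b j 0 = t * (x - b j 0) by ring.
have -> : b j 0 + t * (x - b j 0) = (1 - t) * b j 0 + t * x by ring.
have : `|(1 - t) * b j 0 + t * x| <= (1 - t) * `|b j 0| + t * `|x|.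
  apply: le_trans (ler_normD _ _) _; rewrite !normrM (gtr0_norm t0).
  by rewrite gtr0_norm// subr_gt0.
have := lam_ge0 j; nra.
Qed.

Lemma lasso_obj_continuous (T : topologicalType) (f : T -> 'cV[R]_p) y :
  (forall j, continuous (fun t => f t j 0)) ->
  continuous (fun t => lasso_obj X lam y (f t)).
Proof.
move=> cf t.
have cr i : (y - X *m f z) i 0 @[z --> t] --> (y - X *m f t) i 0.
  under eq_fun do rewrite !mxE; rewrite !mxE.
  apply: cvgB; first exact: cvg_cst.
  by apply: cvg_sumr => j; apply: cvgM; [exact: cvg_cst | exact: cf].
apply: cvgD; first by apply: cvg_sumr => i; apply: cvgM; exact: cr.
apply: cvgM; first exact: cvg_cst.
apply: cvg_sumr => j; apply: cvgM; first exact: cvg_cst.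
by apply: cvg_norm; exact: cf.
Qed.

(** The coordinates of u are recovered from X u by a left inverse of X. *)
Lemma coord_bound (u : 'cV[R]_p) i c : (forall j, `|(X *m u) j 0| <= c) ->
  `|u i 0| <= (\sum_j `|pinvmx X i j|) * c.
Proof.
move=> uc; rewrite -{1}(mul1mx u) -pinvmx_leftK -mulmxA mxE mulr_suml.
apply: le_trans (ler_norm_sum _ _ _) _; apply: ler_sum => j _.
by rewrite normrM ler_wpM2l.
Qed.

(** Coercivity: where the objective does not exceed its value |y|^2 at 0, the
    fit satisfies |X z|^2 <= 4 |y|^2, so that z lies in a fixed compact box. *)
Lemma lasso_minimizer_exists y :
  exists b, forall z, lasso_obj X lam y b <= lasso_obj X lam y z.
Proof.
pose L := lasso_obj X lam y.
pose S i : R := \sum_j `|pinvmx X i j|.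
pose A i : set R := `[- (S i * (1 + 4 * sqnorm y)), S i * (1 + 4 * sqnorm y)]%classic.
pose K := [set v : 'rV[R]_p | forall i, A i (v ord0 i)].
have K0 : K 0.
  move=> i; rewrite /A mxE /= in_itv/= oppr_le0 andbb.
  by rewrite mulr_ge0// ?sumr_ge0// addr_ge0// mulr_ge0// sqnorm_ge0.
have cK : compact K by apply: rV_compact => i; exact: segment_compact.
have cf j : continuous (fun v : 'rV[R]_p => v^T j 0).
  by under eq_fun do rewrite mxE; exact: coord_continuous.
have [c _ cmin] := compact_EVT_min (ex_intro _ _ K0) cK
   (continuous_subspaceT (@lasso_obj_continuous _ trmx y cf)).
exists c^T => z; have [zK|] := pselect (K z^T).
  by have := cmin z^T; rewrite inE trmxK; exact.
have cL : L c^T <= L 0 by have := cmin 0; rewrite inE trmx0; exact.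
move=> zK; apply: le_trans cL _; rewrite leNgt; apply/negP => zL; apply: zK => i.
rewrite /A mxE/= in_itv/= -ler_norml.
apply: coord_bound => k; suff : sqnorm (X *m z) <= 4 * sqnorm y.
  have := sqr_coord_le (X *m z) k; rewrite -(real_normK (num_real _)).
  have := normr_ge0 ((X *m z) k 0); nra.
have pen_ge0 : 0 <= \sum_j lam 0 j * `|z j 0|.
  by apply: sumr_ge0 => j _; rewrite mulr_ge0.
have L0 : L 0 = sqnorm y.
  rewrite /L /lasso_obj mulmx0 subr0 big1 ?mulr0 ?addr0// => j _.
  by rewrite mxE normr0 mulr0.
have : sqnorm (y - X *m z) <= sqnorm y.
  by rewrite -L0; apply: le_trans (ltW zL); rewrite lerDl mulr_ge0.
have -> : X *m z = y - (y - X *m z) by rewrite opprB addrC subrK.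
rewrite opprB addrCA subrr addr0.
(* From |u + v|^2 >= 0 follows |u - v|^2 <= 2 |u|^2 + 2 |v|^2. *)
have := sqnorm_ge0 (y + (y - X *m z)).
rewrite (sqnormD y (y - X *m z)) (sqnormD y (- (y - X *m z))) sqnormN dotvNr.
lra.
Qed.

Lemma lasso_subgrad y :
  subgrad lam (X^T *m (y - X *m lasso X lam y)) (lasso X lam y).
Proof.
have [b bmin] := lasso_minimizer_exists y.
have gb := minimizer_subgrad bmin.
by rewrite /lasso (argminE (subgrad_unique_minimizer gb)).
Qed.

Lemma lassoE y b : subgrad lam (X^T *m (y - X *m b)) b -> lasso X lam y = b.
Proof. by move/subgrad_unique_minimizer/argminE. Qed.

(** Each of the two minimizers is compared with the other by quadratic growth.
    In the sum of the two inequalities the penalties cancel. *)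
Lemma lasso_nonexpansive y1 y2 :
  sqnorm (X *m (lasso X lam y1 - lasso X lam y2)) <= sqnorm (y1 - y2).
Proof.
set b1 := lasso X lam y1; set b2 := lasso X lam y2.
have h1 := subgrad_lasso_obj (lasso_subgrad y1) b2.
have h2 := subgrad_lasso_obj (lasso_subgrad y2) b1.
rewrite -/b1 in h1; rewrite -/b2 in h2.
have e1 : sqnorm (X *m (b2 - b1)) = sqnorm (X *m (b1 - b2)).
  by rewrite -sqnormN -mulmxN opprB.
(* What remains has the form 2 |v|^2 <= 2 u'v, and 2 u'v <= |u|^2 + |v|^2. *)
have := sqnorm_ge0 ((y1 - y2) - X *m (b1 - b2)).
rewrite (sqnormD (y1 - y2)) sqnormN dotvNr.
move: h1 h2; rewrite e1 /lasso_obj.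
rewrite !(sqnormD y1) !(sqnormD y2) !sqnormN !dotvNr mulmxBr.
rewrite !dotvl; lra.
Qed.

Lemma lasso_continuous (T : topologicalType) (f : T -> 'cV[R]_n) i :
  (forall j, continuous (fun t => f t j 0)) ->
  continuous (fun t => lasso X lam (f t) i 0).
Proof.
move=> cf t; apply/cvgrPdist_le => e e0.
pose S : R := \sum_j `|pinvmx X i j|.
have S0 : 0 <= S by rewrite sumr_ge0.
pose c := e / (S + 1).
have c0 : 0 < c by rewrite divr_gt0// ltr_wpDl.
have : sqnorm (f t - f z) @[z --> t] --> sqnorm (f t - f t).
  apply: cvg_sumr => j.
  have cj : (f t - f z) j 0 @[z --> t] --> (f t - f t) j 0.
    under eq_fun do rewrite !mxE; rewrite !mxE.
    by apply: cvgB; [exact: cvg_cst | exact: cf].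
  exact: cvgM.
rewrite subrr {2}/sqnorm /dotv big1; last by move=> j _; rewrite mxE mul0r.
move=> /cvgr_le /(_ (c ^+ 2)); rewrite exprn_gt0// => /(_ isT).
apply: filterS => z zc.
have -> : lasso X lam (f t) i 0 - lasso X lam (f z) i 0 =
          (lasso X lam (f t) - lasso X lam (f z)) i 0 by rewrite !mxE.
apply: le_trans (@coord_bound _ i c _) _ => [j|].
  rewrite -ler_sqr ?nnegrE ?(ltW c0)// real_normK ?num_real//.
  exact: le_trans (sqr_coord_le _ _) (le_trans (lasso_nonexpansive _ _) zc).
by rewrite -/S mulrCA ler_piMr ?(ltW e0)// ler_pdivrMr ?mul1r ?lerDl// ltr_wpDl.
Qed.

End LassoOptimality.

(** * The scaled errors for every value of the noise *)

Section ScaledError.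
Variables (R : realType) (n p : nat) (X : 'M[R]_(n, p)) (lam : 'rV[R]_p).
Hypothesis X_full : \rank X = p.
Hypothesis lam_ge0 : forall j, 0 <= lam 0 j.

(** The scaling by the square root of n degenerates only for n = 0, in which
    case full column rank forces p = 0. An index j : 'I_p is therefore all that
    is needed to know that the scaling is invertible. *)
Lemma obs_gt0 : 'I_p -> (0 < n)%N.
Proof.
case=> j; rewrite -X_full; case: n X => // Y.
by have := rank_leq_row Y; rewrite leqn0 => /eqP ->.
Qed.

Lemma sqrtn_neq0 : 'I_p -> Num.sqrt n%:R != 0 :> R.
Proof. by move=> /obs_gt0 n0; rewrite gt_eqF// sqrtr_gt0 ltr0n. Qed.

(** This form, with the factor 1/n split evenly, holds for n = 0 as well. *)
Lemma gramE (u : 'cV[R]_p) : gram X *m u =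
  (Num.sqrt n%:R)^-1 *: (X^T *m (X *m ((Num.sqrt n%:R)^-1 *: u))).
Proof.
rewrite /gram -!scalemxAr scalerA -scalemxAl mulmxA -expr2 exprVn.
by rewrite sqr_sqrtr// ler0n.
Qed.

Lemma dotv_gram (u v : 'cV[R]_p) : dotv u (gram X *m v) =
  dotv (X *m ((Num.sqrt n%:R)^-1 *: u)) (X *m ((Num.sqrt n%:R)^-1 *: v)).
Proof. by rewrite gramE dotvZr -dotv_mull -dotvZl scalemxAr. Qed.

Lemma gram_sym : (gram X)^T = gram X.
Proof. by rewrite /gram linearZ/= trmx_mul trmxK. Qed.

Lemma dotv_gram_gt0 (u : 'cV[R]_p) : u != 0 -> 0 < dotv u (gram X *m u).
Proof.
move=> u0; rewrite dotv_gram sqnorm_gt0// mulX_neq0//.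
have [j uj] : exists j, u j 0 != 0.
  apply/existsP; apply: contraNT u0 => /existsPn u0; apply/eqP/colP => j.
  by rewrite mxE; apply/eqP/negPn/u0.
by rewrite scaler_eq0 negb_or u0 invr_eq0 sqrtn_neq0.
Qed.

Lemma gram_unit : gram X \in unitmx.
Proof.
rewrite -row_free_unit; apply: inj_row_free => v vG.
apply/eqP/negPn/negP => v0.
have /dotv_gram_gt0 : v^T != 0 by rewrite trmx_eq0.
by rewrite dotvE trmxK mulmxA vG mul0mx mxE ltxx.
Qed.

Lemma uhatdE d e : uhatd X lam d e =
  invmx (gram X) *m (score X e
    - (Num.sqrt n%:R)^-1 *: (diag_mx lam *m sign_vec R d)).
Proof.
set c := _ - _; apply: argminE => z.
set u := invmx _ *m c => zu.
have Gu : gram X *m u = c by rewrite mulKVmx ?gram_unit.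
have QE v : Qd X lam d e v = dotv v (gram X *m v) - 2 * dotv v c.
  rewrite /Qd /c !dotvl.
  have -> : \sum_j lam 0 j * sign_vec R d j 0 * v j 0 =
            dotv v (diag_mx lam *m sign_vec R d).
    by apply: eq_bigr => j _; rewrite mul_diag_mx [in RHS]mxE mulrC.
  ring.
clearbody c; have zu0 : z - u != 0 by rewrite subr_eq0.
have := dotv_gram_gt0 zu0.
rewrite !QE mulmxBr !dotvl Gu (dotvC u (gram X *m z)) dotv_mull gram_sym Gu.
lra.
Qed.

(** With residuals taken at beta + uhat^d / sqrt n, the vector X'(y - X b)
    is Lambda d: the optimality condition of Q^d in the form of the one for the
    Lasso. *)
Lemma score_uhatd d e :
  X^T *m (e - X *m ((Num.sqrt n%:R)^-1 *: uhatd X lam d e)) =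
  diag_mx lam *m sign_vec R d.
Proof.
apply/colP => j; have sn0 := sqrtn_neq0 j.
(* The index j has served its purpose, which is to exclude n = 0. *)
suff -> : X^T *m (e - X *m ((Num.sqrt n%:R)^-1 *: uhatd X lam d e)) =
       diag_mx lam *m sign_vec R d by [].
rewrite mulmxBr; apply: (scalerI (invr_neq0 sn0)).
rewrite scalerBr -gramE uhatdE mulKVmx ?gram_unit// opprB addrC subrK.
by [].
Qed.

(** If beta + uhat^d / sqrt n has sign pattern d, the linear penalty of Q^d and
    the penalty of the Lasso have a common subgradient there. *)
Lemma uhat_eq_uhatd (beta : 'cV[R]_p) d e :
  (forall j, 0 <= sign_vec R d j 0 *
     (beta j 0 + (Num.sqrt n%:R)^-1 * uhatd X lam d e j 0)) ->
  uhat X lam beta e = uhatd X lam d e.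
Proof.
move=> hd; rewrite /uhat (lassoE X_full
  (b := beta + (Num.sqrt n%:R)^-1 *: uhatd X lam d e)); last first.
  have -> : X *m beta + e - X *m (beta + (Num.sqrt n%:R)^-1 *: uhatd X lam d e)
          = e - X *m ((Num.sqrt n%:R)^-1 *: uhatd X lam d e).
    by rewrite mulmxDr opprD addrACA subrr add0r.
  rewrite score_uhatd; apply: subgrad_sign => // j.
  by have := hd j; rewrite !mxE.
apply/colP => j; rewrite addrAC subrr add0r scalerA divff ?scale1r//.
exact: sqrtn_neq0 j.
Qed.

Lemma uhat_coord beta e j : uhat X lam beta e j 0 =
  Num.sqrt n%:R * (lasso X lam (X *m beta + e) j 0 - beta j 0).
Proof. by rewrite /uhat; set b := lasso _ _ _; rewrite !mxE. Qed.

Lemma uhat_continuous (T : topologicalType) (f : T -> 'cV[R]_n) beta j :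
  (forall i, continuous (fun t => f t i 0)) ->
  continuous (fun t => uhat X lam beta (f t) j 0).
Proof.
move=> cf t; under eq_fun do rewrite uhat_coord; rewrite ?uhat_coord.
apply: cvgM; first exact: cvg_cst.
apply: cvgB; last exact: cvg_cst.
apply: (lasso_continuous X_full lam_ge0 (f := fun t => X *m beta + f t)) => i u.
under eq_fun do rewrite mxE; rewrite ?mxE.
by apply: cvgD; [exact: cvg_cst | exact: cf].
Qed.

(** The sign pattern of beta is a valid choice of d for every noise value; only
    the pattern d' fed to Condition A depends on the noise. *)
Lemma uhatd_in_uhat_in (M : set 'cV[R]_p) (beta : 'cV[R]_p) e :
  conditionA (gram X) M ->
  M (uhatd X lam [ffun j => beta j 0 < 0] e) -> M (uhat X lam beta e).
Proof.
move=> hA Md; set d := [ffun _ => _] in Md.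
set b := lasso X lam (X *m beta + e).
set g := X^T *m (X *m beta + e - X *m b).
have gb : subgrad lam g b by exact: lasso_subgrad.
pose s : R := (Num.sqrt n%:R)^-1.
have GuB j : (gram X *m uhat X lam beta e) j 0 =
    (gram X *m uhatd X lam d e) j 0 +
    s * (lam 0 j * sign_vec R d j 0 - g j 0).
  have -> : lam 0 j * sign_vec R d j 0 - g j 0 =
            (diag_mx lam *m sign_vec R d - g) j 0.
    by rewrite mul_diag_mx [RHS]mxE [(- g) _ _]mxE [X in _ = X - _]mxE.
  have -> : gram X *m uhat X lam beta e =
      gram X *m uhatd X lam d e + s *: (diag_mx lam *m sign_vec R d - g).
    rewrite uhatdE mulKVmx ?gram_unit// gramE /score /uhat -/b scalerA.
    rewrite mulVf ?(sqrtn_neq0 j)// scale1r -!scalerBr -scalerDr; congr (_ *: _).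
    rewrite addrA subrK /g -mulmxBr; congr (_ *m _).
    by rewrite mulmxBr opprB opprD addrCA [e + _]addrCA subrr addr0.
  by rewrite [LHS]mxE [X in _ + X = _]mxE.
have s0 (j : 'I_p) : 0 < s by rewrite invr_gt0 lt0r sqrtn_neq0// sqrtr_ge0.
have ub j : uhat X lam beta e j 0 = s^-1 * (b j 0 - beta j 0).
  by rewrite uhat_coord /s invrK.
pose d' := [ffun j => 0 < uhat X lam beta e j 0].
apply: (hA d' _ Md) => j; rewrite {}GuB !sign_vecE ffunE [d j]ffunE.
have := s0 j; move/subgrad_le: (gb) => /(_ lam_ge0 j); rewrite ler_norml.
move=> /andP[gl gu] sj; have sV0 : 0 < s^-1 by rewrite invr_gt0.
case: ltP => [u0|u0].
  rewrite expr1 !mulN1r lerN2 oppr_le0 (ltW u0); split => //.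
  rewrite gerDl pmulr_rle0// subr_le0.
  case: ltP => beta0; first by rewrite expr1 mulrN1.
  (* Here 0 <= beta_j < b_j. *)
  rewrite expr0 mulr1 (subgrad_pos gb)//.
  by move: u0; rewrite ub pmulr_rgt0// subr_gt0; exact: le_lt_trans.
rewrite expr0 !mul1r; split => //.
rewrite lerDl pmulr_rge0// subr_ge0.
case: ltP => beta0; last by rewrite expr0 mulr1.
(* Here b_j <= beta_j < 0. *)
rewrite expr1 mulrN1 (subgrad_neg gb)//.
by move: u0; rewrite ub pmulr_rle0// subr_le0 => /le_lt_trans; exact.
Qed.

End ScaledError.

(** * Borel sets of vectors *)

Section BorelVectors.
Variable R : realType.

Lemma coord_continuous_mx (T : topologicalType) k (f : T -> 'cV[R]_k) :
  (forall j, continuous (fun t => f t j 0)) -> continuous f.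
Proof.
move=> cf t A [P nP PA].
have : \forall z \near t, forall j, P j 0 (f z j 0).
  by apply: filter_forall => j; apply: cf; exact: nP.
by apply: filterS => z Pz; apply: PA => i j; rewrite ord1.
Qed.

Definition rat_box k (q : 'cV[rat]_k * nat) : set 'cV[R]_k :=
  [set u | forall j, `|ratr (q.1 j 0) - u j 0| < q.2.+1%:R^-1].

(** There are only countably many rational boxes, and this is what reduces
    measurability of a random vector to that of its coordinates. *)
Lemma open_bigcup_rat_box k (U : set 'cV[R]_k) : open U ->
  U = \bigcup_(q in [set q | rat_box q `<=` U]) rat_box q.
Proof.
move=> oU; apply/seteqP; split => [u Uu|u [q qU uq]]; last exact: qU.
have /nbhs_ballP[e /= e0 eU] : nbhs u U by exact: open_nbhs_nbhs.
have e20 : 0 < e / 2 by rewrite divr_gt0.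
have [N] := ltr_add_invr e20; rewrite add0r => Ne.
have N0 : 0 < N.+1%:R^-1 :> R by rewrite invr_gt0.
have /choice[q qu] j : exists q : rat, `|ratr q - u j 0| < N.+1%:R^-1.
  have /rat_in_itvoo[q] : u j 0 < u j 0 + N.+1%:R^-1 by rewrite ltrDl.
  rewrite inE => /andP[uq qu]; exists q.
  by rewrite gtr0_norm ?subr_gt0// ltrBlDl.
exists (\col_j q j, N); last by move=> j; rewrite /= mxE.
move=> v vq; apply: eU; split => // i j; rewrite ord1 /ball/=.
have := vq i; have := qu i; rewrite /= mxE => h1 h2.
have -> : u i 0 - v i 0 = (ratr (q i) - v i 0) - (ratr (q i) - u i 0) by ring.
apply: le_lt_trans (ler_normB _ _) _; rewrite [e]splitr ltrD//; exact: lt_trans Ne.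
Qed.

Lemma borel_measurable d (T : measurableType d) k (Z : T -> 'cV[R]_k)
    (B : set 'cV[R]_k) :
  (forall j, measurable_fun [set: T] (fun w => Z w j 0)) -> borel_set B ->
  measurable (Z @^-1` B).
Proof.
move=> mZ; move: B; apply: (@smallest_sub _ _ _ [set A | measurable (Z @^-1` A)]).
  split => /=; first by rewrite preimage_set0.
    by move=> A mA; rewrite setTD preimage_setC; exact: measurableC.
  by move=> A mA; rewrite preimage_bigcup; exact: bigcupT_measurable.
move=> U /open_bigcup_rat_box -> /=; rewrite preimage_bigcup bigcup_mkcond.
apply: countable_bigcupT_measurable => [//|q]; case: ifP => // _.
have -> : Z @^-1` rat_box q = \bigcap_(j in [set: 'I_k])
    ((fun w => `|ratr (q.1 j 0) - Z w j 0|) @^-1` `]-oo, (q.2.+1%:R^-1 : R)[).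
  apply/seteqP; split => w /= h j; first by move=> _; rewrite /= in_itv/=.
  by have := h j I; rewrite /= in_itv/=.
apply: fin_bigcap_measurable => // j _; rewrite -[X in measurable X]setTI.
have mj : measurable_fun [set: T] (fun w => `|ratr (q.1 j 0) - Z w j 0| : R).
  by apply: measurableT_comp => //; exact: measurable_funB.
exact: mj.
Qed.

Lemma borel_preimage k l (f : 'cV[R]_k -> 'cV[R]_l) B :
  (forall j, continuous (fun u => f u j 0)) -> borel_set B ->
  borel_set (f @^-1` B).
Proof.
move=> /coord_continuous_mx /continuousP cf; move: B.
apply: (@smallest_sub _ _ _ [set A | borel_set (f @^-1` A)]).
  split => /=; first by rewrite preimage_set0; exact: sigma_algebra0.
    by move=> A mA; rewrite setTD preimage_setC -setTD; exact: sigma_algebraCD.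
  move=> A mA; rewrite preimage_bigcup; exact: sigma_algebra_bigcup.
by move=> U oU; apply: sub_sigma_algebra; exact: cf.
Qed.

End BorelVectors.

(** * Translation of normal laws *)

Section NormalShift.
Variable R : realType.
Let mu := (@lebesgue_measure R).

Let measurable_shift (c : R) :
  measurable_fun [set: measurableTypeR R] ((fun x => x + c) : R -> measurableTypeR R).
Proof. exact: measurable_funD. Qed.

(** Lebesgue measure is determined by its values on half-open intervals, whose
    length does not change under translation. *)
Lemma lebesgue_measure_shift (c : R) (A : set R) : measurable A ->
  pushforward mu ((fun x => x + c) : _ -> measurableTypeR R) A = mu A.
Proof.
move=> mA; apply/esym/lebesgue_measure_unique => //= _ [[a b]] _ <-.
rewrite /pushforward.
have -> : (fun x : R => x + c) @^-1` `]a, b]%classic = `]a - c, b - c]%classic.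
  by apply/seteqP; split => x /=; rewrite !in_itv/= ltrBlDr lerBrDr.
by rewrite !lebesgue_measure_itv/= !lte_fin ltrD2r -!EFinD opprB addrA subrK.
Qed.

Lemma normal_pdf_shift (m s c x : R) : s != 0 ->
  normal_pdf (m + c) s (x + c) = normal_pdf m s x.
Proof.
move=> s0; rewrite !normal_pdfE// /normal_fun.
by rewrite opprD addrACA subrr addr0.
Qed.

Lemma normal_law_shift (m v c : R) (B : set R) : 0 <= v -> measurable B ->
  normal_law m v ((fun x => x + c) @^-1` B) = normal_law (m + c) v B.
Proof.
rewrite /normal_law le_eqVlt eq_sym => v0 mB.
case: eqVneq v0 => [_ _|v0 /= vp].
  by rewrite !diracE; congr (_%:R%:E).
have s0 : Num.sqrt v != 0 by rewrite gt_eqF// sqrtr_gt0.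
rewrite /normal_prob.
under eq_integral do rewrite -(normal_pdf_shift _ c _ s0).
have := @ge0_integral_pushforward _ _ _ _ R _ (measurable_shift c) mu B
  (fun x => (normal_pdf (m + c) (Num.sqrt v) x)%:E) mB.
move=> <-.
- by apply: eq_measure_integral => //= A mA AB; exact: lebesgue_measure_shift.
- apply/measurable_EFinP/measurable_funTS; exact: measurable_normal_pdf.
- by move=> x _; rewrite lee_fin normal_pdf_ge0.
Qed.

End NormalShift.

(** * Affine images of normal vectors *)

Section NormalVectors.
Variables (R : realType) (disp : measure_display) (T : measurableType disp).
Variable P : probability T R.

Lemma is_normal_coord k (Z : T -> 'cV[R]_k) mu Sigma :
  is_normal P Z mu Sigma ->
  forall j, measurable_fun [set: T] (fun w => Z w j 0).
Proof.
move=> nZ j; have [mZ _] := nZ (delta_mx j 0).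
rewrite (_ : (fun w => Z w j 0) = (fun w => dotv (delta_mx j 0) (Z w)))//.
apply/funext => w; rewrite /dotv (bigD1 j)//= mxE !eqxx mul1r big1 ?addr0//.
by move=> i ij; rewrite mxE (negbTE ij) mul0r.
Qed.

(** A linear form of A Z + c is a linear form of Z plus a constant, so that only
    translations of univariate normal laws occur. Positive
    semidefiniteness of Sigma provides the nonnegative variances that
    [normal_law_shift] asks for. *)
Lemma is_normal_affine k l (Z : T -> 'cV[R]_k) mu Sigma (A : 'M[R]_(l, k)) c :
  (forall a, 0 <= dotv a (Sigma *m a)) ->
  is_normal P Z mu Sigma ->
  is_normal P (fun w => A *m Z w + c) (A *m mu + c) (A *m Sigma *m A^T).
Proof.
move=> psd nZ a; have [mZ lZ] := nZ (A^T *m a).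
have E u : dotv a (A *m u + c) = dotv (A^T *m a) u + dotv a c.
  by rewrite dotvDr dotv_mull trmxK.
have -> : (fun w => dotv a (A *m Z w + c)) =
          (fun w => dotv (A^T *m a) (Z w) + dotv a c).
  by apply/funext => w; exact: E.
split; first exact: measurable_funD.
move=> B mB; rewrite E.
have -> : dotv a (A *m Sigma *m A^T *m a) =
          dotv (A^T *m a) (Sigma *m (A^T *m a)).
  by rewrite -!mulmxA dotv_mull trmxK.
rewrite -normal_law_shift// -lZ//.
rewrite -[X in measurable X]setTI; apply: measurable_funD => //.
Qed.

End NormalVectors.

(** * Laws and probabilities of the scaled errors *)

Section LassoProbability.
Variables (R : realType) (disp : measure_display) (T : measurableType disp).
Variables (P : probability T R) (n p : nat) (X : 'M[R]_(n, p)) (lam : 'rV[R]_p).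
Variables (sigma : R) (eps : T -> 'cV[R]_n).
Hypothesis X_full : \rank X = p.
Hypothesis lam_ge0 : forall j, 0 <= lam 0 j.
Hypothesis eps_normal : is_normal P eps 0 (sigma ^+ 2)%:M.

(** The covariance matrix is sigma^2 A A' with A = C^(-1) X' / sqrt n, and
    A A' = C^(-1) C C^(-1). *)
Lemma uhatd_normal d :
  is_normal P (fun w => uhatd X lam d (eps w))
      (- (Num.sqrt n%:R)^-1 *:
         (invmx (gram X) *m (diag_mx lam *m sign_vec R d)))
      (sigma ^+ 2 *: invmx (gram X)).
Proof.
set c := - _ *: _.
pose A := invmx (gram X) *m ((Num.sqrt n%:R)^-1 *: X^T).
have := @is_normal_affine _ _ _ P _ _ eps 0 (sigma ^+ 2)%:M A c.
have -> : A *m 0 + c = c by rewrite mulmx0 add0r.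
have -> : A *m (sigma ^+ 2)%:M *m A^T = sigma ^+ 2 *: invmx (gram X).
  rewrite scalar_mxC -mulmxA mul_scalar_mx; congr (_ *: _).
  have -> : A^T = (Num.sqrt n%:R)^-1 *: X *m invmx (gram X).
    by rewrite trmx_mul trmx_inv gram_sym [X in X *m _]linearZ/= trmxK.
  rewrite mulmxA -(mulmxA (invmx _)).
  have -> : (Num.sqrt n%:R)^-1 *: X^T *m ((Num.sqrt n%:R)^-1 *: X) = gram X.
    rewrite -scalemxAl -scalemxAr scalerA -expr2 exprVn sqr_sqrtr//.
  by rewrite mulVmx ?gram_unit// mul1mx.
have -> : (fun w => A *m eps w + c) = (fun w => uhatd X lam d (eps w)).
  apply/funext => w; rewrite uhatdE// /A /c /score -mulmxA mulmxBr.
  by rewrite -scalemxAl scaleNr -[in RHS]scalemxAr -[in RHS]scalemxAr -scalemxAr.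
apply => // a; rewrite mul_scalar_mx dotvZr mulr_ge0 ?sqr_ge0//.
exact: sqnorm_ge0.
Qed.

Variable M : set 'cV[R]_p.
Hypothesis M_borel : borel_set M.

Lemma measurable_uhatd d : measurable [set w | M (uhatd X lam d (eps w))].
Proof. exact: (borel_measurable (is_normal_coord (uhatd_normal d)) M_borel). Qed.

Lemma measurable_uhat beta : measurable [set w | M (uhat X lam beta (eps w))].
Proof.
have c_uhat j : continuous (fun e => uhat X lam beta e j 0).
  apply: (uhat_continuous X_full lam_ge0 (f := id)) => i.
  exact: coord_continuous.
have := borel_preimage c_uhat M_borel.
exact: (borel_measurable (is_normal_coord eps_normal)).
Qed.

(** For the parameters t d with t = 0, 1, 2, etc., the event for uhat is contained
    in the event for uhat^d up to an event whose probability tends to 0. *)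
Lemma inf_uhat_le d :
  (ereal_inf [set P [set w | M (uhat X lam beta (eps w))]
             | beta in [set: 'cV[R]_p]]
   <= P [set w | M (uhatd X lam d (eps w))])%E.
Proof.
set V := ereal_inf _; set B := [set w | M (uhatd _ _ _ _)].
pose s : R := (Num.sqrt n%:R)^-1.
(* The events F t decrease to the empty set, and off F t the two errors agree
   when beta is t times the sign vector. *)
pose f j w := sign_vec R d j 0 * (s * uhatd X lam d (eps w) j 0).
pose F t := [set w | exists j, t%:R + f j w < 0].
have mf j : measurable_fun [set: T] (f j).
  have mu := is_normal_coord (uhatd_normal d) j.
  by apply: measurable_funM => //; apply: measurable_funM.
have mF t : measurable (F t).
  have -> : F t = \bigcup_(j in [set: 'I_p]) (f j @^-1` `]-oo, - t%:R[%classic).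
    apply/seteqP; split => w.
      by case=> j h; exists j => //=; rewrite in_itv/= ltrNr -subr_lt0 opprK.
    by case=> j _ /=; rewrite in_itv/= => h; exists j; rewrite addrC -ltrBrDr sub0r.
  apply: fin_bigcup_measurable => // j _.
  by rewrite -[X in measurable X]setTI; exact: mf.
have capF : \bigcap_t F t = set0.
  apply/seteqP; split => // w Fw.
  (* At this t, the sum t + f j w is nonnegative for all j. *)
  pose t := Num.bound (\sum_j `|f j w|).
  have [j] := Fw t I.
  rewrite ltNge => /negP; apply; rewrite -lerBlDr sub0r.
  apply: le_trans (ltW (archi_boundP _)); last by rewrite sumr_ge0.
  rewrite (bigD1 j)//=; apply: le_trans (ler_norm _) _.
  by rewrite normrN lerDl sumr_ge0.
have cF : P (F t) @[t --> \oo] --> 0%E.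
  have := @nonincreasing_cvg_mu _ _ _ P F; rewrite capF measure0; apply => //.
    by rewrite ltey_eq fin_num_measure.
  move=> t t' tt'; apply/subsetPset => w [j fj]; exists j.
  by apply: le_lt_trans fj; rewrite lerD2r ler_nat.
have IF t : (V <= P B + P (F t))%E.
  apply: (@le_trans _ _ (P [set w | M (uhat X lam (t%:R *: sign_vec R d) (eps w))])).
    by apply: ereal_inf_lbound; exists (t%:R *: sign_vec R d).
  apply: (@le_trans _ _ (P (B `|` F t))); last first.
    exact: measureU2 (measurable_uhatd d) (mF t).
  apply: le_measure; rewrite ?inE; [exact: measurable_uhat| |].
    exact: measurableU (measurable_uhatd d) (mF t).
  move=> w Mw; have [Fw|nFw] := pselect (F t w); [by right|left].
  rewrite /B /= -(@uhat_eq_uhatd _ _ _ X lam X_full lam_ge0 (t%:R *: sign_vec R d))//.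
  move=> j; rewrite leNgt; apply/negP => h; apply: nFw; exists j.
  move: h; rewrite [X in _ * (X + _)]mxE mulrDr mulrCA /f sign_vecE.
  by rewrite -expr2 sqrr_sign mulr1.
have cBF : (P B + P (F t))%E @[t --> \oo] --> (P B + 0)%E.
  apply: cvgeD => //; first by rewrite fin_num_adde_defl.
  exact: cvg_cst.
rewrite -[leRHS]adde0 -(cvg_lim _ cBF)//; apply: lime_ge.
  by apply/cvg_ex; exists (P B + 0)%E.
by apply: nearW => t; exact: IF.
Qed.

End LassoProbability.

(** * The infimum over the parameter is a minimum over sign patterns *)

Theorem theorem1 (R : realType) (disp : measure_display)
    (T : measurableType disp) (P : probability T R) (n p : nat)
    (X : 'M[R]_(n, p)) (lam : 'rV[R]_p) (sigma : R) (eps : T -> 'cV[R]_n)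
    (M : set 'cV[R]_p)
    (hX : \rank X = p)
    (hlam : forall j, 0 <= lam 0 j)
    (hsigma : 0 <= sigma)
    (heps : is_normal P eps 0 (sigma ^+ 2)%:M)
    (hM : borel_set M)
    (hA : conditionA (gram X) M) :
  ereal_inf [set P [set w | M (uhat X lam beta (eps w))]
            | beta in [set: 'cV[R]_p]]
  = \big[Order.min/+oo%E]_(d : {ffun 'I_p -> bool})
      P [set w | M (uhatd X lam d (eps w))]
  /\
  forall d : {ffun 'I_p -> bool},
    is_normal P (fun w => uhatd X lam d (eps w))
      (- (Num.sqrt n%:R)^-1 *:
         (invmx (gram X) *m (diag_mx lam *m sign_vec R d)))
      (sigma ^+ 2 *: invmx (gram X)).
Proof.
split; last exact: uhatd_normal.
apply/eqP; rewrite eq_le; apply/andP; split.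
  apply/bigmin_geP; split; first exact: leey.
  by move=> d _; apply: (inf_uhat_le hX hlam heps hM).
apply: le_ereal_inf_tmp => _ [beta _ <-].
apply: (bigmin_inf [ffun j => beta j 0 < 0]) => //.
apply: le_measure; rewrite ?inE.
- exact: (measurable_uhatd lam hX heps hM).
- exact: (measurable_uhat hX hlam heps hM).
- by move=> w; exact: (uhatd_in_uhat_in hX hlam hA).
Qed.
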